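(* Let $G$ be a connected graph of order $n\ge 2$ and let $H$ be a non-trivial graph. Then $$\operatorname{dim}_l(G\odot H)=n\cdot \operatorname{dim}_{A,l}(H).$$
   Context: All graphs are finite, simple, undirected; non-trivial means order at least 2. For a connected graph $G$, $d_G$ is shortest-path distance. A set $S\subseteq V(G)$ is a local metric generator if for every two adjacent vertices $x,y$ there exists $s\in S$ with $d_G(s,x)\ne d_G(s,y)$; $\operatorname{dim}_l(G)$ (local metric dimension) is the minimum size of a local metric generator. A set $S\subseteq V(H)$ is a local adjacency generator for $H$ if for every two adjacent vertices $x,y\in V(H)\setminus S$ there exists $s\in S$ with $|N_H(s)\cap\{x,y\}|=1$ ($N_H$ the open neighbourhood); $\operatorname{dim}_{A,l}(H)$ (local adjacency dimension) is the minimum size of a local adjacency generator. The corona product $G\odot H$ ($G$ of order $n$ with vertices $v_1,\dots,v_n$) consists of $G$ and $n$ disjoint copies $H_1,\dots,H_n$ of $H$, with $v_i$ joined to every vertex of $H_i$.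
   Formalization: The formal theorem also assumes that H has at least one edge; for edgeless H (e.g. G = K_2, H = two isolated vertices) the right side is 0 while the local metric dimension of the corona is at least 1, so the claim fails as stated. *)

(* Defs.v *)
From mathcomp Require Import all_boot.

Set Implicit Arguments.
Unset Strict Implicit.
Unset Printing Implicit Defensive.

Record sgraph := SGraph {
  vert :> finType;
  adj : rel vert;
  adj_sym : symmetric adj;
  adj_irrefl : irreflexive adj
}.

Definition connected (G : sgraph) : Prop :=
  forall x y : G, connect (@adj G) x y.

Definition walk (G : sgraph) (k : nat) (x y : G) : bool :=
  [exists p : k.-tuple G, path (@adj G) x p && (last x p == y)].

(* The least length of a walk from x to y. A shortest walk has fewer than     *)
(* #|G| edges, so lengths below #|G| suffice; if y is not reachable from x,   *)
(* the value is #|G|.                                                         *)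
Definition dist (G : sgraph) (x y : G) : nat :=
  find (fun k => walk k x y) (iota 0 #|G|).

Lemma walkP (G : sgraph) (k : nat) (x y : G) :
  reflect (exists p, [/\ size p = k, path (@adj G) x p & last x p = y])
          (walk k x y).
Proof.
apply: (iffP existsP) => [[p /andP[pP /eqP lP]]|[p [sz pP lP]]].
  by exists p; rewrite size_tuple.
by move/eqP: sz => sz; exists (Tuple sz); rewrite /= pP lP eqxx.
Qed.

Lemma dist_min (G : sgraph) (k : nat) (x y : G) : walk k x y -> dist x y <= k.
Proof.
move=> w; have [kG|Gk] := ltnP k #|G|; last first.
  apply: leq_trans Gk; rewrite -[X in _ <= X](size_iota 0); exact: find_size.
rewrite leqNgt; apply/negP => /(before_find 0).
by rewrite nth_iota // add0n w.
Qed.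

Lemma dist_walk (G : sgraph) (x y : G) :
  connect (@adj G) x y -> walk (dist x y) x y.
Proof.
case/connectP => p pP ->; case/shortenP: pP => q qP uq _.
have sq : size q < #|G| by rewrite -[(size q).+1]/(size (x :: q)) -(card_uniqP uq) max_card.
have h : has (fun k => walk k x (last x q)) (iota 0 #|G|).
  by apply/hasP; exists (size q); [rewrite mem_iota | apply/walkP; exists q].
have := nth_find 0 h; rewrite nth_iota // -[X in _ < X](size_iota 0).
by rewrite -has_find.
Qed.

Definition local_metric_generator (G : sgraph) (S : {set G}) : bool :=
  [forall x : G, forall y : G,
     adj x y ==> [exists s in S, dist s x != dist s y]].

Definition nbhd (H : sgraph) (s : H) : {set H} := [set x | adj s x].

Definition local_adjacency_generator (H : sgraph) (S : {set H}) : bool :=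
  [forall x in ~: S, forall y in ~: S,
     adj x y ==> [exists s in S, #|nbhd s :&: [set x; y]| == 1]].

(* The seed [set: G] of each arg min below must itself be a generator.        *)
Lemma local_metric_generatorT (G : sgraph) :
  local_metric_generator [set: G].
Proof.
apply/forallP => x; apply/forallP => y; apply/implyP => xy.
apply/existsP; exists x; rewrite inE /=.
have d0 : dist x x = 0.
  apply/eqP; rewrite -leqn0; apply: dist_min; apply/walkP.
  by exists [::].
rewrite d0; apply/eqP => /esym d1.
have := dist_walk (connect1 xy); rewrite d1 => /walkP[p [/size0nil -> _ /= e]].
by move: xy; rewrite e adj_irrefl.
Qed.

Lemma local_adjacency_generatorT (H : sgraph) :
  local_adjacency_generator [set: H].
Proof. by apply/forall_inP => x; rewrite !inE. Qed.

Definition dim_l (G : sgraph) : nat :=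
  #|[arg min_(S < [set: G] | local_metric_generator S) #|S|]|.

Definition dim_Al (H : sgraph) : nat :=
  #|[arg min_(S < [set: H] | local_adjacency_generator S) #|S|]|.

(* inl v is the vertex v of G; inr (v, h) is the vertex h of the copy of H    *)
(* attached to v.                                                             *)
Definition corona_adj (G H : sgraph) : rel (G + G * H) := fun u w =>
  match u, w with
  | inl v, inl v' => adj v v'
  | inl v, inr (v', _) => v == v'
  | inr (v, _), inl v' => v == v'
  | inr (v, h), inr (v', h') => (v == v') && adj h h'
  end.

Lemma corona_adj_sym (G H : sgraph) : symmetric (@corona_adj G H).
Proof.
by move=> [v|[v h]] [w|[w k]] //=; rewrite 1?(eq_sym v) // adj_sym.
Qed.

Lemma corona_adj_irrefl (G H : sgraph) : irreflexive (@corona_adj G H).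
Proof. by move=> [v|[v h]] /=; rewrite adj_irrefl ?andbF. Qed.

Definition corona (G H : sgraph) : sgraph :=
  SGraph (@corona_adj_sym G H) (@corona_adj_irrefl G H).

(* Main.v *)
Require Import Defs.
From mathcomp Require Import all_boot.

Set Implicit Arguments.
Unset Strict Implicit.
Unset Printing Implicit Defensive.

(** A vertex outside the copy of [H] at [v] reaches that copy only through [v],
so it separates no edge inside the copy, but it does separate every edge
joining [v] to the copy. Two vertices of the same copy are at distance at most
2, so a vertex of the copy separates the other two exactly when it is adjacent
to just one of them. Hence the trace of a local metric generator on each copy
is a local adjacency generator; conversely, the union of copies of a local
adjacency generator (nonempty, as [H] has an edge) is a local metric generator:
edges [v - w] of [G] are separated by the copy at [v], and edges joining [v] to
its copy by any other copy, which exists as [G] has two vertices. *)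

Lemma dist_eq0 (G : sgraph) (x y : G) :
  connect (@adj G) x y -> (dist x y == 0) = (x == y).
Proof.
move=> cxy; apply/eqP/eqP => [d0|->].
  by have := dist_walk cxy; rewrite d0 => /walkP[p [/size0nil -> _ /= e]].
by apply/eqP; rewrite -leqn0; apply: dist_min; apply/walkP; exists [::].
Qed.

Lemma dist_eq1 (G : sgraph) (x y : G) :
  connect (@adj G) x y -> (dist x y == 1) = adj x y.
Proof.
move=> cxy; apply/eqP/idP => [d1|axy].
  have := dist_walk cxy; rewrite d1 => /walkP[p []].
  by case: p => [|z [|]] //= _; rewrite andbT => xz <-.
apply/eqP; rewrite eqn_leq; apply/andP; split.
  by apply: dist_min; apply/walkP; exists [:: y]; rewrite /= axy.
rewrite lt0n dist_eq0 //; apply: contraTneq axy => ->.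
by rewrite adj_irrefl.
Qed.

Lemma dist_adj_leS (G : sgraph) (s x y : G) :
  connect (@adj G) s x -> adj x y -> dist s y <= (dist s x).+1.
Proof.
move=> csx axy; apply: dist_min; apply/walkP.
have /walkP[p [sp pP lp]] := dist_walk csx.
by exists (rcons p y); rewrite size_rcons sp rcons_path pP lp last_rcons.
Qed.

Lemma dim_l_min (G : sgraph) (S : {set G}) :
  local_metric_generator S -> dim_l G <= #|S|.
Proof.
rewrite /dim_l; case: arg_minnP; first exact: local_metric_generatorT.
by move=> T _; apply.
Qed.

Lemma dim_l_witness (G : sgraph) :
  exists2 S : {set G}, local_metric_generator S & #|S| = dim_l G.
Proof.
rewrite /dim_l; case: arg_minnP; first exact: local_metric_generatorT.
by move=> T gT _; exists T.
Qed.

Lemma dim_Al_min (H : sgraph) (S : {set H}) :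
  local_adjacency_generator S -> dim_Al H <= #|S|.
Proof.
rewrite /dim_Al; case: arg_minnP; first exact: local_adjacency_generatorT.
by move=> T _; apply.
Qed.

Lemma dim_Al_witness (H : sgraph) :
  exists2 S : {set H}, local_adjacency_generator S & #|S| = dim_Al H.
Proof.
rewrite /dim_Al; case: arg_minnP; first exact: local_adjacency_generatorT.
by move=> T gT _; exists T.
Qed.

(** Splitting off [x] turns the cardinality into a sum of two booleans, which is 1 exactly when they
    differ. This form can be compared with distances. *)
Lemma card_nbhdI_pair (H : sgraph) (s x y : H) : x != y ->
  (#|nbhd s :&: [set x; y]| == 1) = (adj s x != adj s y).
Proof.
move=> xy; have -> : #|nbhd s :&: [set x; y]| = adj s x + adj s y.
  rewrite -sum1_card (big_setID [set x]) /=.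
  rewrite !sum1_card; congr (_ + _).
    have -> : nbhd s :&: [set x; y] :&: [set x] = if adj s x then [set x] else set0.
      apply/setP => z; rewrite !inE fun_if; case: (eqVneq z x) => [->|zx].
        by case: ifP; rewrite !inE ?eqxx.
      by case: ifP; rewrite !inE ?(negPf zx) ?andbF.
    by case: ifP; rewrite ?cards1 ?cards0.
  have -> : (nbhd s :&: [set x; y]) :\: [set x] = if adj s y then [set y] else set0.
    apply/setP => z; rewrite !inE fun_if; case: (eqVneq z y) => [->|zy].
      by case: ifP; rewrite !inE ?eqxx ?orbT ?andbT ?andbF // eq_sym xy.
    by case: ifP; rewrite !inE ?(negPf zy) ?orbF; case: (z == x); rewrite ?andbF.
  by case: ifP; rewrite ?cards1 ?cards0.
by do 2 case: (adj _ _).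
Qed.

(** An edge either has an end in [S] or must be separated by a member of [S]. *)
Lemma local_adjacency_generator_neq0 (H : sgraph) (S : {set H}) :
  (exists x y : H, adj x y) -> local_adjacency_generator S ->
  exists h, h \in S.
Proof.
move=> [x [y xy]] gS.
case: (boolP (x \in S)) => [xS|xS]; first by exists x.
case: (boolP (y \in S)) => [yS|yS]; first by exists y.
have xC : x \in ~: S by rewrite inE.
have yC : y \in ~: S by rewrite inE.
have /exists_inP[s sS _] :=
  implyP (forall_inP (forall_inP gS x xC) y yC) xy.
by exists s.
Qed.

Section Corona.

Variables G H : sgraph.
Hypothesis hG : connected G.

Let K := corona G H.
Implicit Types (v w : G) (h k : H) (s : K).

Definition in_copy v s : bool := if s is inr (w, _) then w == v else false.

(** Walks of [G] lift along [inl], and each copy hangs on its root. Connectedness keeps [dist] away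
    from its default value for unreachable vertices. *)
Lemma corona_connected : connected K.
Proof.
have cG v w : connect (@adj K) (inl v) (inl w).
  have /connectP[p pP ->] := hG v w.
  elim: p v pP => [|u p IHp] v //= /andP[vu pP].
  exact: connect_trans (@connect1 _ (@adj K) (inl v) (inl u) vu) (IHp u pP).
have symK : connect_sym (@adj K) by apply: sym_connect_sym; exact: adj_sym.
have root s : exists v, connect (@adj K) (inl v) s.
  case: s => [v|[v h]]; exists v => //.
  by apply: (@connect1 _ (@adj K)); rewrite /= eqxx.
move=> s t; have [v vs] := root s; have [w wt] := root t.
by apply: connect_trans (connect_trans (cG v w) wt); rewrite symK.
Qed.

(** Induction on the length, dropping the last edge: it starts either at the root [v] or at another
    vertex of the same copy. The strict bound supplies the successor in [dist_corona_copy]. *)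
Lemma walk_corona_copy v h s n : ~~ in_copy v s -> @walk K n s (inr (v, h)) ->
  exists2 m, m < n & @walk K m s (inl v).
Proof.
move=> sv; elim: n h => [|n IHn] h /walkP[p [sp pP lp]].
  by move: sv; rewrite (size0nil sp) /= in lp; rewrite lp /= eqxx.
case/lastP: p sp pP lp => [//|p z]; rewrite size_rcons => -[sp].
rewrite rcons_path last_rcons => /andP[pP lz] zE; subst z.
case E : (last s p) lz => [w|[w k]] /=.
  by move/eqP=> <-; exists n => //; apply/walkP; exists p.
case/andP => /eqP wv _; subst w.
have [|m mn wm] := IHn k; first by apply/walkP; exists p.
by exists m => //; exact: ltnW.
Qed.

Lemma dist_corona_copy v h s : ~~ in_copy v s ->
  @dist K s (inr (v, h)) = (@dist K s (inl v)).+1.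
Proof.
move=> sv; apply/eqP; rewrite eqn_leq; apply/andP; split.
  by apply: dist_adj_leS; [exact: corona_connected | rewrite /= eqxx].
have [m lt_m wm] := walk_corona_copy sv (dist_walk (corona_connected s (inr (v, h)))).
exact: leq_ltn_trans (dist_min wm) lt_m.
Qed.

Lemma dist_corona_same v h k : @dist K (inr (v, h)) (inr (v, k)) =
  if h == k then 0 else if adj h k then 1 else 2.
Proof.
have c := corona_connected (inr (v, h)) (inr (v, k)).
have d0 := dist_eq0 c; have d1 := dist_eq1 c; rewrite /= eqxx /= in d1.
have inr_eq : (inr (v, h) == inr (v, k) :> K) = (h == k).
  by apply/eqP/eqP => [[]|->].
rewrite inr_eq in d0.
have d2 : @dist K (inr (v, h)) (inr (v, k)) <= 2.
  apply: dist_min; apply/walkP.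
  (* The detour through the root is available whatever [h] and [k] are. *)
  by exists [:: (inl v : K); inr (v, k)]; rewrite /= !eqxx.
case: (h == k) d0 => [/eqP //|].
by case: (adj h k) d1 => [/eqP //|]; case: dist d2 => [|[|[]]].
Qed.

Lemma local_metric_generator_copy (S : {set K}) v :
  local_metric_generator S ->
  local_adjacency_generator [set h | inr (v, h) \in S].
Proof.
move=> gS; apply/forall_inP => x xS; apply/forall_inP => y yS.
apply/implyP => xy; rewrite !inE in xS yS.
have axy : @adj K (inr (v, x)) (inr (v, y)) by rewrite /= eqxx.
have neq_xy : x != y by apply: contraTneq xy => ->; rewrite adj_irrefl.
have /exists_inP[s sS] := implyP (forallP (forallP gS (inr (v, x))) (inr (v, y))) axy.
case: (boolP (in_copy v s)) => [|sv]; last by rewrite !dist_corona_copy ?eqxx.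
case: s sS => [//|[w h]] sS /= /eqP wv; subst w.
(* As [h] lies in the trace and [x], [y] do not, its distances to them are 1 or 2, so they record
   adjacency. *)
have hx : (h == x) = false by apply: contraNF xS => /eqP <-.
have hy : (h == y) = false by apply: contraNF yS => /eqP <-.
rewrite !dist_corona_same hx hy => neq_d.
apply/exists_inP; exists h; first by rewrite inE.
by rewrite card_nbhdI_pair //; apply: contraNneq neq_d => ->.
Qed.

Lemma local_metric_generator_copies (A : {set H}) :
  1 < #|G| -> (exists x y : H, adj x y) -> local_adjacency_generator A ->
  @local_metric_generator K [set inr p | p in setX [set: G] A].
Proof.
move=> hn hE gA; have [a aA] := local_adjacency_generator_neq0 hE gA.
have inA v h : h \in A -> (inr (v, h) : K) \in [set inr p | p in setX [set: G] A].
  by move=> hA; apply/imset_f; rewrite !inE.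
(* The copy at [v] itself may fail here: its vertices adjacent to [h] are at distance 1 from both
   ends. A second root [w] is used instead. *)
have spoke v h : exists2 s : K, s \in [set inr p | p in setX [set: G] A] &
    @dist K s (inl v) != @dist K s (inr (v, h)).
  have [w wv] : exists w, w != v.
    apply/existsP; rewrite -negb_forall; apply: contraTN hn => /forallP vP.
    rewrite -leqNgt -(cards1 v); apply: subset_leq_card.
    by apply/subsetP => w _; rewrite inE.
  exists (inr (w, a)); first exact: inA.
  by rewrite (@dist_corona_copy v h) //= neq_ltn ltnSn.
apply/forallP => x; apply/forallP => y; apply/implyP => xy; apply/exists_inP.
case: x xy => [v|[v h]]; case: y => [w|[w k]] /=.
(* The only neighbour of [inr (v, a)] among the roots is [v], so its distance to [w] is not 1. *)
- move=> vw; exists (inr (v, a)); first exact: inA.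
  have /eqP -> : @dist K (inr (v, a)) (inl v) == 1.
    by rewrite dist_eq1 /=; [exact: eqxx | exact: corona_connected].
  rewrite eq_sym dist_eq1 /=; last exact: corona_connected.
  by apply: contraTneq vw => ->; rewrite adj_irrefl.
- by move=> /eqP <-; exact: spoke.
- by move=> /eqP <-; have [s sS sP] := spoke v h; exists s => //; rewrite eq_sym.
case/andP => /eqP <- hk.
have neq_hk : h != k by apply: contraTneq hk => ->; rewrite adj_irrefl.
(* An end lying in [A] separates the edge by itself, with distances 0 and 1; only then is [gA]
   needed, for two ends outside [A]. *)
case: (boolP (h \in A)) => [hA|hA].
  by exists (inr (v, h)); [exact: inA | rewrite !dist_corona_same eqxx (negPf neq_hk) hk].
case: (boolP (k \in A)) => [kA|kA].
  exists (inr (v, k)); first exact: inA.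
  by rewrite !dist_corona_same eqxx (eq_sym k) (negPf neq_hk) adj_sym hk.
have hC : h \in ~: A by rewrite inE.
have kC : k \in ~: A by rewrite inE.
have /exists_inP[s sA] := implyP (forall_inP (forall_inP gA h hC) k kC) hk.
rewrite card_nbhdI_pair // => neq_s; exists (inr (v, s)); first exact: inA.
have sh : (s == h) = false by apply: contraNF hA => /eqP <-.
have sk : (s == k) = false by apply: contraNF kA => /eqP <-.
by rewrite !dist_corona_same sh sk; move: neq_s; do 2 case: (adj _ _).
Qed.

(** The traces correspond to disjoint parts of [S]; roots belonging to [S] go uncounted, hence only
    an inequality. *)
Lemma sum_card_copies_le (S : {set K}) :
  \sum_v #|[set h | inr (v, h) \in S]| <= #|S|.
Proof.
have -> : \sum_v #|[set h | inr (v, h) \in S]| = #|[set p : G * H | inr p \in S]|.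
  rewrite -sum1_card (eq_bigr (fun v => \sum_(h | inr (v, h) \in S) 1)).
    by rewrite pair_big_dep /=; apply: eq_bigl => -[v h]; rewrite inE.
  by move=> v _; rewrite -sum1_card; apply: eq_bigl => h; rewrite inE.
have inr_inj : injective (@inr G (G * H)) by move=> ? ? [].
rewrite -(card_imset _ inr_inj); apply: subset_leq_card.
by apply/subsetP => s /imsetP[p]; rewrite inE => pS ->.
Qed.

End Corona.

Theorem theorem17 (G H : sgraph) (hG : connected G) (hn : 2 <= #|G|)
  (hH : 2 <= #|H|) (hE : exists x y : H, adj x y) :
  dim_l (corona G H) = #|G| * dim_Al H.
Proof.
apply/eqP; rewrite eqn_leq; apply/andP; split.
  have [A gA <-] := dim_Al_witness H.
  have /dim_l_min/leq_trans := @local_metric_generator_copies G H hG A hn hE gA.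
  apply; apply: leq_trans (leq_imset_card _ _) _.
  by rewrite cardsX cardsT.
(* Lower bound: each of the [#|G|] traces of a minimum generator has at least [dim_Al H]
   elements. *)
have [S gS <-] := dim_l_witness (corona G H).
apply: leq_trans (@sum_card_copies_le G H S).
rewrite -sum_nat_const; apply: leq_sum => v _.
exact/dim_Al_min/local_metric_generator_copy.
Qed.
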